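(* Let $A$ be an integral domain. The set $\mathrm{SStar}_f(A)$ of all semistar operations of finite type on $A$, endowed with the Zariski topology, is a spectral space.
   Context: Let $A$ be an integral domain with quotient field $K$. $\overline{\mathbf F}(A)$ is the set of all nonzero $A$-submodules of $K$, and $\mathbf f(A)$ is the set of all nonzero finitely generated fractional ideals of $A$ (nonzero finitely generated $A$-submodules of $K$). A semistar operation on $A$ is a map $\star:\overline{\mathbf F}(A)\to\overline{\mathbf F}(A)$, $F\mapsto F^\star$, such that for all nonzero $k\in K$ and all $F,G\in\overline{\mathbf F}(A)$: $(kF)^\star=kF^\star$; $F\subseteq G$ implies $F^\star\subseteq G^\star$; $F\subseteq F^\star$; $(F^\star)^\star=F^\star$. $\mathrm{SStar}(A)$ is the set of all semistar operations on $A$. The Zariski topology on $\mathrm{SStar}(A)$ is the topology having as a subbasis of open sets the sets $V_F:=\{\star\in\mathrm{SStar}(A):1\in F^\star\}$, for $F\in\overline{\mathbf F}(A)$. A semistar operation $\star$ is of finite type if $F^\star=\bigcup\{G^\star:G\in\mathbf f(A),\,G\subseteq F\}$ for every $F\in\overline{\mathbf F}(A)$. $\mathrm{SStar}_f(A)$ is the set of semistar operations of finite type on $A$, and its Zariski topology is the subspace topology from $\mathrm{SStar}(A)$. A topological space is spectral if it is homeomorphic to the prime spectrum of a commutative ring with identity endowed with the Zariski topology. *)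

(* Defs.v *)
From HB Require Import structures.
From mathcomp Require Import all_boot all_order all_algebra.
From mathcomp Require Import all_classical topology.

Set Implicit Arguments.
Unset Strict Implicit.
Unset Printing Implicit Defensive.

Import GRing.Theory.
Local Open Scope classical_set_scope.
Local Open Scope ring_scope.

(* Full MathComp commutative rings with identity, the zero ring included;
   ring_quotient's [prime_idealr] is restricted to nonzero rings and to boolean
   predicates. *)
Record prime_ideal (R : comPzRingType) := PrimeIdeal {
  prime_set :> set R;
  prime0 : prime_set 0;
  primeD : forall x y, prime_set x -> prime_set y -> prime_set (x + y);
  primeMr : forall a x, prime_set x -> prime_set (a * x);
  prime1 : ~ prime_set 1;
  primeM : forall x y, prime_set (x * y) -> prime_set x \/ prime_set y
}.

HB.instance Definition _ (R : comPzRingType) := gen_eqMixin (prime_ideal R).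
HB.instance Definition _ (R : comPzRingType) := gen_choiceMixin (prime_ideal R).

Section SpecTopology.
Variable R : comPzRingType.

Definition zero_locus (S : set R) : set (prime_ideal R) :=
  [set P | S `<=` P].

Definition spec_open : set_system (prime_ideal R) :=
  [set U | exists S : set R, U = ~` zero_locus S].

Lemma spec_openT : spec_open setT.
Proof.
exists setT; apply/seteqP; split=> // P _ /= TP.
by apply: (@prime1 _ P); apply: TP.
Qed.

Lemma spec_openI : setI_closed spec_open.
Proof.
move=> _ _ [S ->] [T ->].
exists [set z | exists x y, [/\ S x, T y & z = x * y]].
apply/seteqP; split=> P /=.
  case=> nSP nTP STP; apply: nSP => x Sx; apply: contrapT => nPx.
  apply: nTP => y Ty.
  have Pxy : prime_set P (x * y) by apply: STP; exists x, y.
  by case: (primeM Pxy).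
move=> nST; split=> SP; apply: nST => _ [x [y [Sx Ty ->]]].
  by rewrite mulrC; apply/primeMr/SP.
exact/primeMr/SP.
Qed.

Lemma spec_open_bigcup (I : Type) (f : I -> set (prime_ideal R)) :
  (forall i, spec_open (f i)) -> spec_open (\bigcup_i f i).
Proof.
move=> fo; exists (\bigcup_(S in [set S | exists i, f i = ~` zero_locus S]) S).
apply/seteqP; split=> P /=.
  move=> [i _ fiP] SP; have [S fiE] := fo i; move: (fiP); rewrite fiE.
  by apply=> x Sx; apply: SP; exists S => //; exists i.
move=> nSP; apply: contrapT => nfP; apply: nSP => x [S [i fiE] Sx].
apply: contrapT => nPx; apply: nfP; exists i => //; rewrite fiE.
by move=> SP; apply/nPx/SP.
Qed.

HB.instance Definition _ :=
  isOpenTopological.Build (prime_ideal R) spec_openT spec_openI spec_open_bigcup.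

End SpecTopology.

Definition homeomorphic (X Y : topologicalType) :=
  exists (f : X -> Y) (g : Y -> X),
    [/\ cancel f g, cancel g f, continuous f & continuous g].

Definition spectral_space (X : topologicalType) :=
  exists R : comPzRingType, homeomorphic X (prime_ideal R).

Record nzsubmod (A : idomainType) := NzSubmod {
  submod_set :> set {fraction A};
  submod0 : submod_set 0;
  submodD : forall x y, submod_set x -> submod_set y -> submod_set (x + y);
  submodZ : forall (a : A) x, submod_set x -> submod_set (tofrac a * x);
  submod_neq0 : exists2 x, submod_set x & x != 0
}.

Section NzSubmod.
Variable A : idomainType.
Local Notation K := {fraction A}.

Lemma nzsubmodT_neq0 : exists2 x : K, [set: K] x & x != 0.
Proof. by exists 1 => //; exact: oner_neq0. Qed.

Definition nzsubmodT : nzsubmod A :=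
  @NzSubmod A setT I (fun _ _ _ _ => I) (fun _ _ _ => I) nzsubmodT_neq0.

HB.instance Definition _ := gen_eqMixin (nzsubmod A).
HB.instance Definition _ := gen_choiceMixin (nzsubmod A).
(* The library's subbasis factory wants a pointed index type. *)
HB.instance Definition _ := isPointed.Build (nzsubmod A) nzsubmodT.

Section Scale.
Variables (k : K) (k0 : k != 0) (F : nzsubmod A).

Definition scale_set : set K := [set k * x | x in F].

Lemma scale_set0 : scale_set 0.
Proof. by exists 0; [exact: submod0 | rewrite mulr0]. Qed.

Lemma scale_setD x y : scale_set x -> scale_set y -> scale_set (x + y).
Proof.
move=> [x' Fx <-] [y' Fy <-]; exists (x' + y'); last by rewrite mulrDr.
exact: submodD.
Qed.

Lemma scale_setZ (a : A) x : scale_set x -> scale_set (tofrac a * x).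
Proof.
move=> [x' Fx <-]; exists (tofrac a * x'); last by rewrite mulrCA.
exact: submodZ.
Qed.

Lemma scale_set_neq0 : exists2 x, scale_set x & x != 0.
Proof.
have [x Fx x0] := submod_neq0 F.
by exists (k * x); [exists x | rewrite mulf_neq0].
Qed.

Definition scale_nzsubmod : nzsubmod A :=
  NzSubmod scale_set0 scale_setD scale_setZ scale_set_neq0.
End Scale.

Definition fin_gen (F : nzsubmod A) :=
  exists s : seq K, F = [set x | exists c : 'I_(size s) -> A,
    x = \sum_(i < size s) tofrac (c i) * s`_i] :> set K.

End NzSubmod.

Record semistar (A : idomainType) := Semistar {
  star :> nzsubmod A -> nzsubmod A;
  star_scale : forall (k : {fraction A}) (k0 : k != 0) (F : nzsubmod A),
    star (scale_nzsubmod k0 F) = scale_nzsubmod k0 (star F);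
  star_mono : forall F G : nzsubmod A, F `<=` G -> star F `<=` star G;
  star_ext : forall F : nzsubmod A, F `<=` star F;
  star_idem : forall F : nzsubmod A, star (star F) = star F
}.

Section ZariskiSemistar.
Variable A : idomainType.

Definition zariski_subbase (F : nzsubmod A) : set (semistar A) :=
  [set s : semistar A | submod_set (s F) 1].

HB.instance Definition _ := gen_eqMixin (semistar A).
HB.instance Definition _ := gen_choiceMixin (semistar A).
HB.instance Definition _ :=
  isSubBaseTopological.Build (semistar A) [set: nzsubmod A] zariski_subbase.

Definition finite_type (s : semistar A) :=
  forall F : nzsubmod A, s F =
    \bigcup_(G in [set G : nzsubmod A | fin_gen G /\ G `<=` F]) s G
      :> set {fraction A}.

End ZariskiSemistar.

(* As a type, this subset carries the library's subspace topology (the initial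
   topology of the inclusion into [semistar A]). *)
Definition semistar_f (A : idomainType) : set (semistar A) :=
  [set s | finite_type s].
Arguments semistar_f : clear implicits.

(* Main.v *)
From HB Require Import structures.
Require Import Defs.
From mathcomp Require Import all_boot all_order all_algebra.
From mathcomp Require Import finmap all_classical topology.
From mathcomp Require Import ring zify.

(** A semistar operation of finite type is determined by the finitely generated
    modules whose star contains 1, because a nonzero [x] lies in the star of [G]
    exactly when [1] lies in the star of [x^-1 G].  The sets of modules that arise in this
    way are the sets closed under every implication with finitely many premises
    that holds for all operations of finite type
    ([modules_at_one_closure_system]): from such a set an operation is rebuilt by
    adding to [F] all that the set forces into the star of a finitely generated
    submodule of [F].  In these terms the Zariski topology has the sets of
    operations whose set of modules contains a given [G] as a subbasis.  The
    theorem is therefore an instance of [closure_system_spectral]: let sets [S t]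
    of variables be the closed sets of an algebraic closure operator, and let the
    points [t] carry the topology with subbasis [set t | S t e]; then this space
    is a prime spectrum.

    The ring is built inside the field [Q] of rational functions in the variables
    [e], in the spirit of Hochster.  A set [S] of variables defines a valuation
    of [Q], the order in the variables outside [S], which is trivial on the
    subfield [K_S] generated by the variables in [S].  An element [a] of [Q] is
    coherent if for every inclusion of [S t] in [S t'] some [r] in [K_(S t')] is
    congruent to [a] for both valuations.  Coherent elements form a ring, and the
    elements of positive valuation at [t] form a prime ideal of it, the center
    of [t]; the variable [e] belongs to this ideal if and only if [e] is not in
    [S t].

    Everything rests on a divisibility statement ([coherent_divides]): if [b] lies
    in every center that contains [a], then a power of [b] is a coherent multiple
    of [a].  The exponent must be uniform in [t], and it is, because the values of
    [a] and of its residues are bounded by the degree of a numerator of [a]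
    ([ordval_bound]).  Consequently inclusions between loci of centers decide
    membership in all prime ideals.  Given a prime ideal [p], let [Z] be the set of
    variables outside [p].  If finitely many variables in [Z] entail [y], then the
    center of [t] contains their product whenever it contains [y], so [y] is in
    [Z]; hence [Z = S t] for some [t].  An element involves finitely many
    variables, and comparing it with products and sums of these shows that [p] is
    the center of [t] ([prime_is_center]). *)

Set Implicit Arguments.
Unset Strict Implicit.
Unset Printing Implicit Defensive.

Import Order.TTheory GRing.Theory Num.Theory.
Local Open Scope classical_set_scope.
Local Open Scope ring_scope.

(** * The order of vanishing at the origin *)

Section OrderAtZero.
Variable R : idomainType.
Implicit Types p q : {poly R}.

(** The zero polynomial is given the value 0. *)
Definition lowdeg p : nat := find (fun c => c != 0) p.

Lemma coef_lowdeg p : p != 0 -> p`_(lowdeg p) != 0.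
Proof.
move=> p0; apply: (@nth_find R 0 (fun c => c != 0)); apply/(has_nthP 0).
exists (size p).-1; first by rewrite prednK ?size_poly_gt0.
by rewrite -lead_coefE lead_coef_eq0.
Qed.

Lemma coef_lt_lowdeg p i : (i < lowdeg p)%N -> p`_i = 0.
Proof. by move=> ip; apply/eqP; move: (before_find 0 ip) => /negbT; rewrite negbK. Qed.

Lemma lowdeg_ge p n : p != 0 -> (forall i, (i < n)%N -> p`_i = 0) -> (n <= lowdeg p)%N.
Proof.
by move=> p0 pn; rewrite leqNgt; apply/negP => /pn /eqP; exact/negP/coef_lowdeg.
Qed.

Lemma lowdeg_unique p n : p`_n != 0 -> (forall i, (i < n)%N -> p`_i = 0) -> lowdeg p = n.
Proof.
move=> pn pln; have p0 : p != 0 by apply: contraNneq pn => ->; rewrite coef0.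
apply/eqP; rewrite eqn_leq lowdeg_ge// andbT leqNgt; apply/negP => /coef_lt_lowdeg /eqP.
exact/negP.
Qed.

Lemma coefM_lowdeg p q :
  (p * q)`_(lowdeg p + lowdeg q) = p`_(lowdeg p) * q`_(lowdeg q).
Proof.
have lt : (lowdeg p < (lowdeg p + lowdeg q).+1)%N by rewrite ltnS leq_addr.
rewrite coefM (bigD1 (Ordinal lt))//= addKn big1 ?addr0// => i.
rewrite -val_eqE/= neq_ltn => /orP[ip|pi]; first by rewrite coef_lt_lowdeg// mul0r.
by rewrite [q`_ _]coef_lt_lowdeg ?mulr0//; have := ltn_ord i; lia.
Qed.

Lemma coefM_lt_lowdeg p q i : (i < lowdeg p + lowdeg q)%N -> (p * q)`_i = 0.
Proof.
move=> ipq; rewrite coefM big1// => j _.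
have [jp|pj] := ltnP j (lowdeg p); first by rewrite coef_lt_lowdeg// mul0r.
by rewrite [q`_ _]coef_lt_lowdeg ?mulr0//; have := ltn_ord j; lia.
Qed.

Lemma lowdegM p q : p != 0 -> q != 0 -> lowdeg (p * q) = (lowdeg p + lowdeg q)%N.
Proof.
move=> p0 q0; apply: lowdeg_unique; last by move=> i; exact: coefM_lt_lowdeg.
by rewrite coefM_lowdeg mulf_neq0// coef_lowdeg.
Qed.

Lemma lowdegD p q : p + q != 0 -> (minn (lowdeg p) (lowdeg q) <= lowdeg (p + q))%N.
Proof.
move=> pq; apply: lowdeg_ge => // i; rewrite leq_min => /andP[ip iq].
by rewrite coefD !coef_lt_lowdeg// addr0.
Qed.

Lemma lowdegC (c : R) : lowdeg c%:P = 0%N.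
Proof.
have [->|c0] := eqVneq c 0; first by rewrite /lowdeg polyseq0.
by apply: lowdeg_unique => //; rewrite coefC eqxx.
Qed.

Lemma lowdeg1 : lowdeg (1 : {poly R}) = 0%N.
Proof. exact: (lowdegC 1). Qed.

Lemma lowdeg_lt_size p : p != 0 -> (lowdeg p < size p)%N.
Proof.
move=> p0; rewrite ltnNge; apply/negP => h.
by have := coef_lowdeg p0; rewrite nth_default// eqxx.
Qed.

End OrderAtZero.

(** * Polynomial functions in arbitrarily many variables *)

Section PolynomialFunctions.
Variable E : Type.

(** Polynomials are taken as functions, on rational points: over an infinite field
    nothing is lost, and substitutions become compositions. *)
Inductive is_polyfun : ((E -> rat) -> rat) -> Prop :=
| polyfun_cst c : is_polyfun (fun=> c)
| polyfun_coord e : is_polyfun (fun x => x e)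
| polyfun_add f g : is_polyfun f -> is_polyfun g -> is_polyfun (f + g)
| polyfun_mul f g : is_polyfun f -> is_polyfun g -> is_polyfun (f * g).

Definition polyfun_pred : {pred (E -> rat) -> rat} := fun f => `[< is_polyfun f >].

Lemma polyfun_subring : subring_closed polyfun_pred.
Proof.
split=> [|f g|f g]; rewrite ?inE.
- exact: (polyfun_cst 1).
- move=> pf pg; rewrite -mulN1r; apply: polyfun_add => //.
  by apply: polyfun_mul => //; exact: (polyfun_cst (-1)).
- exact: polyfun_mul.
Qed.

HB.instance Definition _ :=
  GRing.isSubringClosed.Build _ polyfun_pred polyfun_subring.

Record polyfun := PolyFun
  { polyfun_val :> (E -> rat) -> rat; _ : polyfun_val \in polyfun_pred }.

HB.instance Definition _ := [isSub for polyfun_val].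
HB.instance Definition _ := [Choice of polyfun by <:].
HB.instance Definition _ :=
  GRing.SubChoice_isSubComPzRing.Build _ _ polyfun polyfun_subring.

Lemma polyfun_inj (f g : polyfun) : f =1 g -> f = g.
Proof. by move=> fg; apply/val_inj/funext. Qed.

Definition const_fun (c : rat) : polyfun :=
  @PolyFun (fun=> c) (asboolT (polyfun_cst c)).

Definition indet (e : E) : polyfun :=
  @PolyFun (fun x => x e) (asboolT (polyfun_coord e)).

Lemma polyfunD (f g : polyfun) x : (f + g) x = f x + g x. Proof. by []. Qed.
Lemma polyfunB (f g : polyfun) x : (f - g) x = f x - g x. Proof. by []. Qed.
Lemma polyfunM (f g : polyfun) x : (f * g) x = f x * g x. Proof. by []. Qed.
Lemma polyfun0 x : (0 : polyfun) x = 0. Proof. by []. Qed.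
Lemma polyfun_sum (I : Type) (s : seq I) (F : I -> polyfun) x :
  (\sum_(i <- s) F i) x = \sum_(i <- s) F i x.
Proof. by elim: s => [|i s IH]; rewrite ?big_nil// !big_cons polyfunD IH. Qed.

Lemma polyfun_induction (P : polyfun -> Prop) :
  (forall c, P (const_fun c)) -> (forall e, P (indet e)) ->
  (forall f g, P f -> P g -> P (f + g)) ->
  (forall f g, P f -> P g -> P (f * g)) -> forall f, P f.
Proof.
move=> Pc Px PD PM [f pf]; have := pf; rewrite inE => pf'.
elim: pf' pf => {f} [c|e|f g hf Pf hg Pg|f g hf Pf hg Pg] pfg.
- by rewrite (_ : PolyFun _ = const_fun c) //; exact: val_inj.
- by rewrite (_ : PolyFun _ = indet e) //; exact: val_inj.
- have -> : PolyFun pfg = PolyFun (asboolT hf) + PolyFun (asboolT hg) by exact: val_inj.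
  exact: PD.
- have -> : PolyFun pfg = PolyFun (asboolT hf) * PolyFun (asboolT hg) by exact: val_inj.
  exact: PM.
Qed.

(** Restriction to curves reduces questions to one variable. *)
Lemma polyfun_curve (u : E -> {poly rat}) (f : polyfun) :
  exists p : {poly rat}, forall c, p.[c] = f (fun e => (u e).[c]).
Proof.
elim/polyfun_induction: f => [c|e|f g [p pE] [q qE]|f g [p pE] [q qE]].
- by exists c%:P => d; rewrite hornerC.
- by exists (u e).
- by exists (p + q) => c; rewrite hornerD pE qE.
- by exists (p * q) => c; rewrite hornerM pE qE.
Qed.

Lemma poly_rat_eq0 (p : {poly rat}) : (forall c, p.[c] = 0) -> p = 0.
Proof.
move=> p0; apply/eqP; apply: contraT => pn0.
have := @max_poly_roots _ p [seq i%:R | i <- iota 0 (size p)] pn0.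
rewrite size_map size_iota ltnn; apply.
  by apply/allP => c _; apply/eqP.
by rewrite map_inj_uniq ?iota_uniq// => i j /eqP; rewrite eqr_nat => /eqP.
Qed.

(** Two points where [f] and [g] respectively do not vanish lie on a line, and
    restricting to this line reduces the claim to univariate polynomials. *)
Lemma polyfun_integral (f g : polyfun) : f * g = 0 -> f = 0 \/ g = 0.
Proof.
move=> fg0; apply: contrapT => /not_orP[f0 g0].
have {f0} [x fx] : exists x, f x != 0.
  apply: contrapT => /forallNP h; apply: f0; apply: polyfun_inj => x.
  by rewrite polyfun0; apply/eqP; move: (h x) => /negP; rewrite negbK.
have {g0} [y gy] : exists y, g y != 0.
  apply: contrapT => /forallNP h; apply: g0; apply: polyfun_inj => y.
  by rewrite polyfun0; apply/eqP; move: (h y) => /negP; rewrite negbK.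
pose u e : {poly rat} := (x e)%:P + 'X * (y e - x e)%:P.
have u0 : (fun e => (u e).[0]) = x.
  by apply/funext => e; rewrite /u hornerD hornerM !hornerC hornerX; ring.
have u1 : (fun e => (u e).[1]) = y.
  by apply/funext => e; rewrite /u hornerD hornerM !hornerC hornerX; ring.
have [p pE] := polyfun_curve u f; have [q qE] := polyfun_curve u g.
have pq0 : p * q = 0.
  by apply: poly_rat_eq0 => c; rewrite hornerM pE qE -polyfunM fg0.
have /eqP := pq0; rewrite mulf_eq0 => /orP[]/eqP h.
  by move: (pE 0); rewrite u0 h horner0 => /esym/eqP; exact/negP.
by move: (qE 1); rewrite u1 h horner0 => /esym/eqP; exact/negP.
Qed.

Lemma polyfun_oner_neq0 : (1 : polyfun) != 0.
Proof. by apply/eqP => /(congr1 (fun f : polyfun => f (fun=> 0)))/eqP. Qed.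

HB.instance Definition _ :=
  GRing.PzSemiRing_isNonZero.Build polyfun polyfun_oner_neq0.

Definition polyfun_unit : {pred polyfun} := fun f => `[< exists g, g * f = 1 >].

Definition polyfun_inv (f : polyfun) : polyfun :=
  if pselect (exists g, g * f = 1) is left h then projT1 (cid h) else f.

Lemma polyfun_mulVx : {in polyfun_unit, left_inverse 1 polyfun_inv *%R}.
Proof.
move=> f; rewrite inE => uf; rewrite /polyfun_inv.
by case: pselect => [h|]//; case: cid.
Qed.

Lemma polyfun_unitPl f g : g * f = 1 -> polyfun_unit f.
Proof. by move=> gf; apply/asboolP; exists g. Qed.

Lemma polyfun_inv_out : {in [predC polyfun_unit], polyfun_inv =1 id}.
Proof.
move=> f; rewrite !inE => uf; rewrite /polyfun_inv.
by case: pselect => // h; move/asboolP: uf; case.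
Qed.

HB.instance Definition _ := GRing.ComNzRing_hasMulInverse.Build polyfun
  polyfun_mulVx polyfun_unitPl polyfun_inv_out.

Lemma polyfun_mulf_eq0 : GRing.integral_domain_axiom polyfun.
Proof.
by move=> f g /polyfun_integral[] ->; rewrite eqxx ?orbT.
Qed.

HB.instance Definition _ :=
  GRing.ComUnitRing_isIntegral.Build polyfun polyfun_mulf_eq0.

End PolynomialFunctions.

Arguments const_fun {E}.
Arguments indet {E}.

(** * Order valuations on fraction fields *)

Lemma fracE (R : idomainType) (a : {fraction R}) :
  exists p q : R, q != 0 /\ a = tofrac p / tofrac q.
Proof.
elim/quotW: a => x; exists x.1, x.2; split; first exact: denom_ratioP.
rewrite -[x in LHS]Ratio_numden; case: x => [[n d] /= d0].
rewrite !piE; apply/eqmodP => /=; rewrite FracField.equivfE.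
by rewrite !numden_Ratio ?mulf_neq0 ?mul1r ?mulr1 ?oner_neq0//= mulrC.
Qed.

Lemma frac_congr_identity (F : fieldType) (a r x y : F) : a != 0 -> r != 0 ->
  x / a - y / r = (x - y) * a^-1 - (a - r) * (y * (a^-1 * r^-1)).
Proof. by move=> a0 r0; field; rewrite a0 r0. Qed.

Section OrderValuation.
Variables (R : idomainType) (phi : {rmorphism R -> {poly R}}).
Hypothesis phi_inj : injective phi.
Local Notation Q := {fraction R}.
Implicit Types (a b r s : Q) (p q f g : R).

Lemma phi_eq0 p : (phi p == 0) = (p == 0).
Proof. by rewrite -(inj_eq phi_inj) rmorph0. Qed.

(** The choice of numerator and denominator is immaterial ([ordval_frac]) except at
    0, whose value is meaningless. *)
Definition ordval a : int :=
  let pq := cid (fracE a) in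
  (lowdeg (phi (projT1 pq)))%:Z - (lowdeg (phi (projT1 (cid (projT2 pq)))))%:Z.

Lemma ordval_frac p q : p != 0 -> q != 0 ->
  ordval (tofrac p / tofrac q) = (lowdeg (phi p))%:Z - (lowdeg (phi q))%:Z.
Proof.
move=> p0 q0; rewrite /ordval; case: cid => p' /= hp; case: cid => q' /= [q'0 e].
have p'0 : p' != 0.
  apply: contraNneq p0 => p'0; move/eqP: e.
  by rewrite p'0 tofrac0 mul0r mulf_eq0 invr_eq0 !tofrac_eq0 (negbTE q0) orbF.
have /eqP : tofrac (p * q') = tofrac (p' * q).
  move/eqP: e; rewrite eqr_div ?tofrac_eq0// => /eqP e.
  by rewrite !tofracM.
rewrite tofrac_eq => /eqP /(congr1 (fun f => lowdeg (phi f))).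
by rewrite !rmorphM !lowdegM ?phi_eq0//; lia.
Qed.

Lemma ordvalM a b : a != 0 -> b != 0 -> ordval (a * b) = ordval a + ordval b.
Proof.
have [p [q [q0 ->]]] := fracE a; have [r [s [s0 ->]]] := fracE b.
rewrite !mulf_eq0 !invr_eq0 !tofrac_eq0 (negbTE q0) (negbTE s0) !orbF => p0 r0.
rewrite mulf_div -!tofracM !ordval_frac ?mulf_neq0// !rmorphM !lowdegM ?phi_eq0//.
lia.
Qed.

Lemma ordval1 : ordval 1 = 0.
Proof.
have n0 : (1 : Q) != 0 by exact: oner_neq0.
have := ordvalM n0 n0; rewrite mulr1; lia.
Qed.

Lemma ordvalV a : a != 0 -> ordval a^-1 = - ordval a.
Proof.
move=> a0; have := ordvalM a0 (invr_neq0 a0); rewrite divff// ordval1; lia.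
Qed.

Lemma ordvalD a b (n : int) : a != 0 -> b != 0 -> a + b != 0 ->
  n <= ordval a -> n <= ordval b -> n <= ordval (a + b).
Proof.
have [p [q [q0 ->]]] := fracE a; have [r [s [s0 ->]]] := fracE b.
rewrite addf_div ?tofrac_eq0// -!tofracM -tofracD.
rewrite !mulf_eq0 !invr_eq0 !tofrac_eq0 mulf_eq0 (negbTE q0) (negbTE s0) !orbF.
move=> p0 r0 pr0; rewrite !ordval_frac ?mulf_neq0//.
have : phi (p * s + r * q) != 0 by rewrite phi_eq0.
rewrite rmorphD => /lowdegD; rewrite !rmorphM !lowdegM ?phi_eq0//.
move: (lowdeg (_ + _)) (lowdeg (phi p)) (lowdeg (phi q)) (lowdeg (phi r)) (lowdeg (phi s)).
move=> x1 x2 x3 x4 x5; lia.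
Qed.

(** In this form of the comparison 0 has infinite valuation. *)
Definition vge (n : int) a : bool := (a == 0) || (n <= ordval a).

Lemma vge_0 n : vge n 0.
Proof. by rewrite /vge eqxx. Qed.

Lemma vge_le (m n : int) a : m <= n -> vge n a -> vge m a.
Proof. by rewrite /vge; case: (a == 0) => //= mn; exact: le_trans. Qed.

Lemma vgeD n a b : vge n a -> vge n b -> vge n (a + b).
Proof.
rewrite /vge; have [->|a0] := eqVneq a 0; first by rewrite add0r.
have [->|b0] := eqVneq b 0; first by rewrite addr0 (negbTE a0).
by have [//|ab0 /= na nb] := eqVneq (a + b) 0; exact: ordvalD.
Qed.

Lemma vgeM m n a b : vge m a -> vge n b -> vge (m + n) (a * b).
Proof.
rewrite /vge; have [->|a0] := eqVneq a 0; first by rewrite mul0r eqxx.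
have [->|b0] := eqVneq b 0; first by rewrite mulr0 eqxx.
by rewrite mulf_eq0 (negbTE a0) (negbTE b0)/= ordvalM//; exact: lerD.
Qed.

Lemma vgeN n a : vge n (- a) = vge n a.
Proof.
rewrite /vge oppr_eq0; have [//|a0/=] := eqVneq a 0.
have n1 : (-1 : Q) != 0 by rewrite oppr_eq0 oner_neq0.
have := ordvalM n1 n1; rewrite mulrNN mulr1 ordval1 => h.
by rewrite -mulN1r ordvalM//; congr (_ <= _); lia.
Qed.

Lemma vgeB n a b : vge n a -> vge n b -> vge n (a - b).
Proof. by move=> na nb; apply: vgeD; rewrite ?vgeN. Qed.

Lemma vgeX (m : int) a n : vge m a -> vge (m *+ n) (a ^+ n).
Proof.
move=> ma; elim: n => [|n IH]; first by rewrite /vge expr0 mulr0n ordval1 lexx orbT.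
by rewrite exprS mulrS vgeM.
Qed.

Lemma vge1_tofrac p : vge 1 (tofrac p) = ((phi p)`_0 == 0).
Proof.
rewrite /vge tofrac_eq0; have [->|p0/=] := eqVneq p 0.
  by rewrite (_ : phi 0 = 0) ?rmorph0// coef0 eqxx.
rewrite -[tofrac p]divr1 -tofrac1 ordval_frac ?oner_neq0// rmorph1.
rewrite lowdeg1 subr0; apply/idP/eqP => [h|h].
  by apply: coef_lt_lowdeg; lia.
suff : (0 < lowdeg (phi p))%N by lia.
by apply: lowdeg_ge; rewrite ?phi_eq0// => -[].
Qed.

Lemma vge_nz n a : a != 0 -> vge n a = (n <= ordval a).
Proof. by move=> a0; rewrite /vge (negbTE a0). Qed.

Lemma vge1_0 a : vge 1 a -> vge 0 a.
Proof. exact: vge_le. Qed.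

Lemma vge0M a b : vge 0 a -> vge 0 b -> vge 0 (a * b).
Proof. by move=> ha hb; rewrite -[0]addr0; exact: vgeM. Qed.

Lemma vge0X a n : vge 0 a -> vge 0 (a ^+ n).
Proof. by move=> ha; have := vgeX n ha; rewrite mul0rn. Qed.

Lemma vge10M a b : vge 1 a -> vge 0 b -> vge 1 (a * b).
Proof. by move=> ha hb; rewrite -[1]addr0; exact: vgeM. Qed.

Lemma vge01M a b : vge 0 a -> vge 1 b -> vge 1 (a * b).
Proof. by move=> ha hb; rewrite mulrC; exact: vge10M. Qed.

Lemma vge1_prime a b : vge 0 a -> vge 0 b ->
  vge 1 (a * b) -> vge 1 a \/ vge 1 b.
Proof.
have [->|a0] := eqVneq a 0; first by left; exact: vge_0.
have [->|b0] := eqVneq b 0; first by right; exact: vge_0.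
rewrite !vge_nz ?mulf_neq0// ordvalM//.
move: (ordval a) (ordval b) => x y; lia.
Qed.

Lemma vge_unit a : vge 0 a -> ~~ vge 1 a -> a != 0 /\ ordval a = 0.
Proof.
move=> ha na; have a0 : a != 0 by apply: contraNneq na => ->; exact: vge_0.
by split=> //; move: ha na; rewrite !vge_nz//; lia.
Qed.

Lemma vgeV a : a != 0 -> vge (- ordval a) a^-1.
Proof.
by move=> a0; rewrite vge_nz ?invr_eq0// ordvalV//.
Qed.

(** When [phi] multiplies the variables outside a set by ['X], this is the field
    generated by the variables in the set.  The valuation is trivial there, so it
    is a subfield of the residue field. *)
Definition fixed_field r := exists p q : R,
  [/\ q != 0, phi p = p%:P, phi q = q%:P & r = tofrac p / tofrac q].

Lemma fixed_field_tofrac f : phi f = f%:P -> fixed_field (tofrac f).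
Proof.
move=> Sf; exists f, 1; split=> //; first exact: oner_neq0.
  by rewrite rmorph1.
by rewrite tofrac1 divr1.
Qed.

Lemma fixed_field0 : fixed_field 0.
Proof. by rewrite -tofrac0; apply: fixed_field_tofrac; rewrite rmorph0. Qed.

Lemma fixed_field1 : fixed_field 1.
Proof. by rewrite -tofrac1; apply: fixed_field_tofrac; rewrite rmorph1. Qed.

Lemma fixed_fieldM r s : fixed_field r -> fixed_field s -> fixed_field (r * s).
Proof.
move=> [p [q [q0 Sp Sq ->]]] [p' [q' [q0' Sp' Sq' ->]]].
exists (p * p'), (q * q'); split; rewrite ?mulf_neq0//.
- by rewrite rmorphM/= Sp Sp' -polyCM.
- by rewrite rmorphM/= Sq Sq' -polyCM.
- by rewrite mulf_div !tofracM.
Qed.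

Lemma fixed_fieldB r s : fixed_field r -> fixed_field s -> fixed_field (r - s).
Proof.
move=> [p [q [q0 Sp Sq ->]]] [p' [q' [q0' Sp' Sq' ->]]].
exists (p * q' - p' * q), (q * q'); split; rewrite ?mulf_neq0//.
- by rewrite rmorphB !rmorphM/= Sp Sp' Sq Sq' -!polyCM -polyCB.
- by rewrite rmorphM/= Sq Sq' -polyCM.
- by rewrite -mulNr addf_div ?tofrac_eq0// tofracB !tofracM mulNr.
Qed.

Lemma fixed_fieldV r : fixed_field r -> fixed_field r^-1.
Proof.
move=> [p [q [q0 Sp Sq ->]]]; have [->|p0] := eqVneq p 0.
  by rewrite tofrac0 mul0r invr0; exact: fixed_field0.
by exists q, p; split=> //; rewrite invf_div.
Qed.

Lemma fixed_fieldX r n : fixed_field r -> fixed_field (r ^+ n).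
Proof.
move=> Sr; elim: n => [|n IH]; first exact: fixed_field1.
by rewrite exprS; exact: fixed_fieldM.
Qed.

Lemma ordval_fixed_field r : fixed_field r -> r != 0 -> ordval r = 0.
Proof.
move=> [p [q [q0 Sp Sq ->]]].
rewrite mulf_eq0 invr_eq0 !tofrac_eq0 (negbTE q0) orbF => p0.
by rewrite ordval_frac// ?Sp ?Sq ?lowdegC ?subrr//.
Qed.

Lemma fixed_field_vge0 r : fixed_field r -> vge 0 r.
Proof.
move=> Sr; have [->|r0] := eqVneq r 0; first exact: vge_0.
by rewrite vge_nz// ordval_fixed_field.
Qed.

Lemma fixed_field_vge1 r : fixed_field r -> vge 1 r -> r = 0.
Proof. by move=> Sr; apply: contraTeq => r0; rewrite vge_nz// ordval_fixed_field. Qed.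

(** If [r = p / q] with [p] and [q] fixed, then the congruence makes the term of
    degree [n] of [f * q - p * g] vanish, where [n] is the common order of [f] and
    [g].  The formula serves to bound the values of residues. *)
Lemma residue_leading_forms f g r : f != 0 -> g != 0 ->
    ordval (tofrac f / tofrac g) = 0 ->
    fixed_field r -> vge 1 (tofrac f / tofrac g - r) ->
  r = tofrac (phi f)`_(lowdeg (phi f))
    / tofrac (phi g)`_(lowdeg (phi g)).
Proof.
move=> f0 g0; rewrite ordval_frac//.
move=> /eqP; rewrite subr_eq0 => /eqP -[fg] [p [q [q0 Sp Sq ->]]].
rewrite -mulNr addf_div ?tofrac_eq0// mulNr -!tofracM -tofracB.
set n := lowdeg (phi g) in fg *.
move=> h; have : (phi (f * q - p * g))`_n = 0.
  have [->|fpg] := eqVneq (f * q - p * g) 0; first by rewrite rmorph0 coef0.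
  move: h; rewrite vge_nz ?mulf_neq0 ?invr_eq0 ?tofrac_eq0 ?mulf_neq0//.
  rewrite ordval_frac ?mulf_neq0//.
  rewrite [phi (g * q)]rmorphM/= lowdegM ?phi_eq0// Sq lowdegC -/n.
  have ltZ (i j : nat) : 1 <= i%:Z - j%:Z -> (j < i)%N by lia.
  by rewrite addn0 => h; apply/coef_lt_lowdeg/ltZ.
rewrite rmorphB !rmorphM/= Sp Sq coefB coefMC coefCM -/n => /eqP.
rewrite fg subr_eq0 => /eqP e.
have gn : (phi g)`_n != 0 by rewrite coef_lowdeg// phi_eq0.
by apply/eqP; rewrite eqr_div ?tofrac_eq0// -!tofracM -e mulrC.
Qed.

Lemma vge1_div a b (d : nat) :
  a != 0 -> ordval a <= d%:Z -> vge 1 b -> vge 1 (b ^+ d.+1 / a).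
Proof.
move=> a0 ad b1; apply: (vge_le _ (vgeM (vgeX d.+1 b1) (vgeV a0))).
by rewrite natz; lia.
Qed.

Lemma vge1_subX a b n : vge 0 a -> vge 0 b -> vge 1 (a - b) ->
  vge 1 (a ^+ n - b ^+ n).
Proof.
move=> ha hb ab; rewrite subrXX; apply: vge10M => //.
elim/big_ind: _ => [|x y|i _]; [exact: vge_0|exact: vgeD|].
by apply: vge0M; exact: vge0X.
Qed.

(** The element [a] is a unit, so passage to residues commutes with the quotient. *)
Lemma vge1_frac_congr a b r s n : vge 0 a -> ~~ vge 1 a -> vge 0 b ->
    vge 1 (a - r) -> vge 1 (b - s) ->
  vge 1 (b ^+ n / a - s ^+ n / r).
Proof.
move=> ha na hb ar bs.
have [a0 va] := vge_unit ha na.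
have hr : vge 0 r by rewrite -[r](subKr a); apply: vgeB => //; exact: vge1_0.
have hs : vge 0 s by rewrite -[s](subKr b); apply: vgeB => //; exact: vge1_0.
have [r0 vr] : r != 0 /\ ordval r = 0.
  by apply: vge_unit => //; apply: contra na => r1; rewrite -[a](subrK r); exact: vgeD.
have hV x : x != 0 -> ordval x = 0 -> vge 0 x^-1.
  by move=> x0 vx; have := vgeV x0; rewrite vx oppr0.
have -> : b ^+ n / a - s ^+ n / r =
    (b ^+ n - s ^+ n) * a^-1 - (a - r) * (s ^+ n * (a^-1 * r^-1)).
  exact: frac_congr_identity.
apply: vgeB; apply: vge10M => //; [exact: vge1_subX|exact: hV|].
by apply: vge0M; [exact: vge0X|apply: vge0M; exact: hV].
Qed.

End OrderValuation.

(** For scalings, [d] is the total degree of [f], which bounds its degree in any set of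
    variables and is not exceeded by the degrees of the coefficients of [phi S' f]. *)
Definition degree_bounded (P : idomainType) (I : Type)
    (phi : I -> {rmorphism P -> {poly P}}) :=
  forall f, exists d : nat, forall S,
    (size (phi S f) <= d.+1)%N /\
    forall S' i, (size (phi S (phi S' f)`_i)%R <= d.+1)%N.

Section FamilyBound.
Variables (P : idomainType) (I : Type) (phi : I -> {rmorphism P -> {poly P}}).
Hypothesis phi_inj : forall S, injective (phi S).
Implicit Types (S : I) (f g : P) (a r : {fraction P}).

Hypothesis phi_degree : degree_bounded phi.

(** The bound depends on neither [S] nor [S']: the values are at most the degree of
    a numerator of [a]. *)
Lemma ordval_bound a : a != 0 -> exists d : nat, forall S,
  ordval (phi S) a <= d%:Z /\
  forall S' r, ordval (phi S') a = 0 -> fixed_field (phi S') r ->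
    vge (phi S') 1 (a - r) -> ordval (phi S) r <= d%:Z.
Proof.
have [f [g [g0 ->]]] := fracE a.
rewrite mulf_eq0 invr_eq0 !tofrac_eq0 (negbTE g0) orbF => f0.
have [d Hd] := phi_degree f; exists d => S; split.
  rewrite (ordval_frac (@phi_inj _))//.
  have [fd _] := Hd S.
  have : (lowdeg (phi S f) < size (phi S f))%N.
    by apply: lowdeg_lt_size; rewrite (phi_eq0 (@phi_inj S)).
  move: (size _) fd (lowdeg (phi S f)) (lowdeg (phi S g)) => *; lia.
move=> S' r v0 Kr ar; rewrite (residue_leading_forms (@phi_inj S') f0 g0 v0 Kr ar).
set F := (phi S' f)`__; set G := (phi S' g)`__.
have F0 : F != 0 by rewrite coef_lowdeg// (phi_eq0 (@phi_inj S')).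
have G0 : G != 0 by rewrite coef_lowdeg// (phi_eq0 (@phi_inj S')).
rewrite (ordval_frac (@phi_inj _))//.
have [_ /(_ S' (lowdeg (phi S' f)))] := Hd S; rewrite -/F => fd.
have : (lowdeg (phi S F) < size (phi S F))%N.
  by apply: lowdeg_lt_size; rewrite (phi_eq0 (@phi_inj S)).
move: (size _) fd (lowdeg (phi S F)) (lowdeg (phi S G)) => *; lia.
Qed.

End FamilyBound.

(** * Scaling the variables outside a set *)

Section Scaling.
Variable E : eqType.
Local Notation P := (GRing.IntegralDomain.clone (polyfun E) _).
Implicit Types (S : set E) (f g : P).

Lemma poly_polyfun_ext (p q : {poly P}) :
  (forall c, p.[const_fun c] = q.[const_fun c]) -> p = q.
Proof.
move=> pq; apply/eqP; rewrite -subr_eq0; apply: contraT => r0.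
have := @max_poly_roots _ _ [seq const_fun i%:R | i <- iota 0 (size (p - q))] r0.
rewrite size_map size_iota ltnn; apply.
  apply/allP => _ /mapP[c _ ->]; apply/eqP.
  by rewrite hornerD hornerN pq subrr.
rewrite map_inj_uniq ?iota_uniq// => i j /(congr1 (fun f : P => f (fun=> 0)))/=.
by move=> /eqP; rewrite eqr_nat => /eqP.
Qed.

Definition scale_coords S (c : rat) (x : E -> rat) : E -> rat :=
  fun e => if `[< S e >] then x e else x e * c.

Lemma scaling_exists S f :
  exists p : {poly P}, forall c x, p.[const_fun c] x = f (scale_coords S c x).
Proof.
elim/polyfun_induction: f => [c|e|f g [p pE] [q qE]|f g [p pE] [q qE]].
- by exists (const_fun c)%:P => d x; rewrite hornerC.
- exists (if `[< S e >] then (indet e)%:P else (indet e)%:P * 'X) => c x.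
  by rewrite /= /scale_coords; case: ifP => _; rewrite ?hornerM !hornerC// hornerX.
- by exists (p + q) => c x; rewrite hornerD !polyfunD pE qE.
- by exists (p * q) => c x; rewrite hornerM !polyfunM pE qE.
Qed.

(** The substitution of [e * 'X] for [e] outside [S]: the power of ['X] records the
    degree in the variables outside [S]. *)
Definition scaling S f : {poly P} := projT1 (cid (scaling_exists S f)).

Lemma scalingE S f c x : (scaling S f).[const_fun c] x = f (scale_coords S c x).
Proof. by rewrite /scaling; case: cid. Qed.

Lemma scaling_unique S f p :
  (forall c x, p.[const_fun c] x = f (scale_coords S c x)) -> scaling S f = p.
Proof.
by move=> pE; apply: poly_polyfun_ext => c; apply: polyfun_inj => x; rewrite scalingE pE.
Qed.

Lemma scaling_zmod_morphism S : zmod_morphism (scaling S).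
Proof.
move=> f g; apply: scaling_unique => c x.
by rewrite hornerD hornerN !polyfunB !scalingE.
Qed.

Lemma scaling_monoid_morphism S : monoid_morphism (scaling S).
Proof.
split=> [|f g]; first by apply: scaling_unique => c x; rewrite hornerC.
by apply: scaling_unique => c x; rewrite hornerM polyfunM !scalingE.
Qed.

HB.instance Definition _ S :=
  GRing.isZmodMorphism.Build P {poly P} (scaling S) (scaling_zmod_morphism S).
HB.instance Definition _ S :=
  GRing.isMonoidMorphism.Build P {poly P} (scaling S) (scaling_monoid_morphism S).

Lemma scaling_inj S : injective (scaling S).
Proof.
move=> f g fg; apply: polyfun_inj => x.
have sx : scale_coords S 1 x = x.
  by apply/funext => e; rewrite /scale_coords mulr1; case: ifP.
by have := scalingE S f 1 x; rewrite fg scalingE sx.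
Qed.

Lemma scaling_const S c : scaling S (const_fun c) = (const_fun c)%:P.
Proof. by apply: scaling_unique => d x; rewrite hornerC. Qed.

Lemma scaling_indet_in S e : S e -> scaling S (indet e) = (indet e)%:P.
Proof.
move=> Se; apply: scaling_unique => d x.
by rewrite hornerC /= /scale_coords asboolT.
Qed.

Lemma scaling_indet_notin S e : ~ S e -> scaling S (indet e) = (indet e)%:P * 'X.
Proof.
move=> Se; apply: scaling_unique => d x.
by rewrite hornerM hornerC hornerX /= /scale_coords asboolF.
Qed.

Lemma scaling_setT f : scaling setT f = f%:P.
Proof.
apply: scaling_unique => c x; rewrite hornerC; congr (polyfun_val f _).
by apply/funext => e; rewrite /scale_coords asboolT.
Qed.

Definition agree (L : seq E) S S' := forall e, e \in L -> (S e <-> S' e).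

(** A polynomial function involves finitely many variables, those in [L]. *)
Lemma scaling_support f :
  exists L : seq E, forall S S', agree L S S' -> scaling S f = scaling S' f.
Proof.
elim/polyfun_induction: f => [c|e|f g [L HL] [M HM]|f g [L HL] [M HM]].
- by exists [::] => S S' _; rewrite !scaling_const.
- exists [:: e] => S S' /(_ e (mem_head _ _)) SS'.
  have [Se|Se] := pselect (S e).
    by rewrite !scaling_indet_in//; apply/SS'.
  by rewrite !scaling_indet_notin// -SS'.
- exists (L ++ M) => S S' SS'.
  by rewrite !rmorphD/= (HL S S') ?(HM S S')// => e eL;
    apply: SS'; rewrite mem_cat eL ?orbT.
- exists (L ++ M) => S S' SS'.
  by rewrite !rmorphM/= (HL S S') ?(HM S S')// => e eL;
    apply: SS'; rewrite mem_cat eL ?orbT.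
Qed.

(** The total degree of [f] is such a bound, since scaling and taking coefficients
    do not increase it. *)
Lemma scaling_size f : exists d : nat, forall S S' i,
  (size (scaling S (scaling S' f)`_i) <= d.+1)%N.
Proof.
elim/polyfun_induction: f => [c|e|f g [d Hd] [b Hb]|f g [d Hd] [b Hb]].
- exists 0%N => S S' i; rewrite scaling_const coefC.
  case: ifP => _; rewrite ?rmorph0 ?size_poly0// scaling_const.
  exact: size_polyC_leq1.
- exists 1%N => S S' i; suff : (scaling S' (indet e))`_i = indet e \/
      (scaling S' (indet e))`_i = 0.
    case=> ->; last by rewrite rmorph0 size_poly0.
    have [Se|Se] := pselect (S e).
      by rewrite scaling_indet_in// (leq_trans (size_polyC_leq1 _)).
    rewrite scaling_indet_notin// (leq_trans (size_polyMleq _ _))//.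
    by rewrite size_polyX addn2/= (leq_ltn_trans (size_polyC_leq1 _)).
  have [Se|Se] := pselect (S' e).
    by rewrite scaling_indet_in// coefC; case: ifP; [left|right].
  rewrite scaling_indet_notin// coefMX coefC.
  by case: ifP => _; [right|case: ifP; [left|right]].
- exists (maxn d b) => S S' i; rewrite rmorphD coefD rmorphD.
  rewrite (leq_trans (size_polyD _ _))// geq_max.
  by rewrite (leq_trans (Hd _ _ _)) ?(leq_trans (Hb _ _ _))// ltnS (leq_maxl, leq_maxr).
- exists (d + b)%N => S S' i; rewrite rmorphM coefM rmorph_sum.
  apply: (leq_trans (size_sum _ _ _)); apply/bigmax_leqP => j _.
  rewrite rmorphM/= (leq_trans (size_polyMleq _ _))//.
  have := leq_add (Hd S S' j) (Hb S S' (i - j)%N).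
  by move: (size _ + size _)%N => n; lia.
Qed.

End Scaling.

(** * Elements with coherent residues *)

Section Coherent.
Variables (P : idomainType) (T : Type) (phi : T -> {rmorphism P -> {poly P}}).
Variable le : T -> T -> Prop.
Hypothesis phi_inj : forall t, injective (phi t).
Hypothesis le_refl : forall t, le t t.
Local Notation Q := {fraction P}.
Implicit Types (t : T) (a b r : Q).

(** Pairs are essential.  Suppose that the points are the four sets of variables among
    [x] and [y].  If only [t = t'] were considered, then [x / (x + y ^+ 2)] would
    qualify, although its residue is 1 at the empty set and 0 at the set consisting
    of [y]: it would be a unit at a point and a non-unit at a larger one. *)
Definition coherent a := forall t t', le t t' ->
  exists r, [/\ fixed_field (phi t') r, vge (phi t) 1 (a - r) & vge (phi t') 1 (a - r)].

Lemma coherent_vge0 a t : coherent a -> vge (phi t) 0 a.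
Proof.
move=> /(_ t t (le_refl t))[r [Kr ar _]]; rewrite -[a](subrK r).
by apply: vgeD => //; [exact: vge1_0|exact: fixed_field_vge0].
Qed.

Lemma coherent_fixed_field a : (forall t', fixed_field (phi t') a) -> coherent a.
Proof.
move=> Ka t t' _; exists a; rewrite subrr.
by split; [exact: Ka|exact: vge_0|exact: vge_0].
Qed.

Lemma coherent1 : coherent 1.
Proof. by apply: coherent_fixed_field => t; exact: fixed_field1. Qed.

Lemma coherentB a b : coherent a -> coherent b -> coherent (a - b).
Proof.
move=> ca cb t t' tt'; have [r [Kr ar ar']] := ca t t' tt'.
have [s [Ks bs bs']] := cb t t' tt'; exists (r - s).
have -> : a - b - (r - s) = (a - r) - (b - s).
  by rewrite !opprB addrACA [in RHS]addrACA [- b - r]addrC.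
by split; [exact: fixed_fieldB|exact: vgeB|exact: vgeB].
Qed.

Lemma coherentM a b : coherent a -> coherent b -> coherent (a * b).
Proof.
move=> ca cb t t' tt'; have [r [Kr ar ar']] := ca t t' tt'.
have [s [Ks bs bs']] := cb t t' tt'; exists (r * s).
have vr u : vge (phi u) 1 (a - r) -> vge (phi u) 0 r.
  move=> aru; rewrite -[r](subKr a); apply: vgeB => //; last exact: vge1_0.
  exact: coherent_vge0.
have vrs u : vge (phi u) 1 (a - r) -> vge (phi u) 1 (b - s) ->
    vge (phi u) 1 (a * b - r * s).
  move=> aru bsu; have -> : a * b - r * s = (a - r) * b + r * (b - s).
    by rewrite mulrBl mulrBr addrA subrK.
  apply: vgeD => //; [apply: vge10M|apply: vge01M] => //; last exact: vr.
  exact: coherent_vge0.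
by split; [exact: fixed_fieldM|exact: vrs|exact: vrs].
Qed.

(** If [a] has positive value at [t'], so does [r], which is then 0 because the
    valuation is trivial on the field that contains it. *)
Lemma coherent_mono a t t' : coherent a -> le t t' ->
  vge (phi t') 1 a -> vge (phi t) 1 a.
Proof.
move=> ca tt' a1; have [r [Kr ar ar']] := ca t t' tt'.
have r0 : r = 0.
  by apply: (fixed_field_vge1 (@phi_inj t') Kr); rewrite -[r](subKr a); exact: vgeB.
by rewrite r0 subr0 in ar.
Qed.

Hypothesis phi_degree : degree_bounded phi.

(** If [a] has positive value at [t'], hence at [t], then so has [b], and a large
    power of [b] makes the residue of the quotient 0.  Otherwise [a] is a unit at
    [t'] and the quotient of the residues [s ^+ n] and [r] at [t'] approximates
    [b ^+ n / a].  At [t] this is clear if [a] is a unit there too; if not, both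
    fractions have positive value at [t], as [n] exceeds the values of [a] and
    [r]. *)
Lemma coherent_divides a b : coherent a -> coherent b -> a != 0 ->
  (forall t, vge (phi t) 1 a -> vge (phi t) 1 b) -> exists n, coherent (b ^+ n / a).
Proof.
move=> ca cb a0 ab; have [d Hd] := ordval_bound phi_inj phi_degree a0.
exists d.+1 => t t' tt'.
have [a1'|na1'] := boolP (vge (phi t') 1 a).
  have a1 := coherent_mono ca tt' a1'.
  exists 0; rewrite subr0; split; first exact: fixed_field0.
    by apply: vge1_div => //; [have [] := Hd t|exact: ab].
  by apply: vge1_div => //; [have [] := Hd t'|exact: ab].
have [r [Kr ar ar']] := ca t t' tt'; have [s [Ks bs bs']] := cb t t' tt'.
have [_ va'] := vge_unit (coherent_vge0 t' ca) na1'.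
exists (s ^+ d.+1 / r); split.
- by apply: fixed_fieldM => //; [exact: fixed_fieldX|exact: fixed_fieldV].
- have [a1|na1] := boolP (vge (phi t) 1 a); last first.
    by apply: vge1_frac_congr => //; exact: coherent_vge0.
  have b1 := ab t a1; apply: vgeB => //.
    by apply: vge1_div => //; have [] := Hd t.
  have s1 : vge (phi t) 1 s by rewrite -[s](subKr b); exact: vgeB.
  have r0 : r != 0 by apply: contraNneq na1' => r0; rewrite r0 subr0 in ar'.
  by apply: vge1_div => //; have [_ /(_ t' r va' Kr ar')] := Hd t.
- by apply: vge1_frac_congr => //; exact: coherent_vge0.
Qed.

End Coherent.

(** * Prime ideals *)

Section PrimeIdeals.
Variable R : comPzRingType.
Implicit Types (p q : prime_ideal R) (a b : R).

Lemma prime_ideal_ext p q : prime_set p =1 prime_set q -> p = q.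
Proof.
move=> /funext.
case: p q => [p p0 pD pM p1 pP] [q q0 qD qM q1 qP] /= e; subst q.
by congr PrimeIdeal; exact: Prop_irrelevance.
Qed.

Lemma prime_expE p a n : prime_set p (a ^+ n) -> prime_set p a.
Proof.
elim: n => [|n IH]; first by rewrite expr0 => /prime1.
by rewrite exprS => /primeM[].
Qed.

Lemma prime_prodE p (I : eqType) (l : seq I) (F : I -> R) :
  prime_set p (\prod_(i <- l) F i) <-> exists2 i, i \in l & prime_set p (F i).
Proof.
elim: l => [|i l IH]; first by rewrite big_nil; split=> [/prime1|[]].
rewrite big_cons; split.
  case/primeM => [pi|/IH[j jl pj]]; first by exists i; rewrite ?mem_head.
  by exists j; rewrite // inE jl orbT.
case=> j; rewrite inE => /orP[/eqP -> pi|jl pj].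
  by rewrite mulrC; exact: primeMr.
by apply: primeMr; apply/IH; exists j.
Qed.

Lemma prime_sum p (I : eqType) (l : seq I) (F : I -> R) :
  (forall i, i \in l -> prime_set p (F i)) -> prime_set p (\sum_(i <- l) F i).
Proof.
elim: l => [|i l IH] h; first by rewrite big_nil; exact: prime0.
rewrite big_cons; apply: primeD; first by apply: h; rewrite mem_head.
by apply: IH => j jl; apply: h; rewrite inE jl orbT.
Qed.

Lemma open_prime_notin a : open [set p | ~ prime_set p a].
Proof.
have : spec_open [set p | ~ prime_set p a].
  exists [set a]; apply/seteqP; split=> p /= pa; first by move=> /(_ a erefl).
  by move=> h; apply: pa => b ->.
by [].
Qed.

End PrimeIdeals.

(** * The ring of coherent elements and its centers *)

Section CoherentRing.
Variables (E : eqType) (T : Type) (S : T -> set E).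
Local Notation P := (GRing.IntegralDomain.clone (polyfun E) _).
Local Notation Q := {fraction P}.

Definition scaling_at (t : T) : {rmorphism P -> {poly P}} := scaling (S t).
Definition below t t' := S t `<=` S t'.

Lemma scaling_at_inj t : injective (scaling_at t).
Proof. exact: scaling_inj. Qed.

Lemma below_refl t : below t t.
Proof. by []. Qed.

Definition coherent_pred : {pred Q} := fun a => `[< coherent scaling_at below a >].

Lemma coherent_subring : subring_closed coherent_pred.
Proof.
split=> [|a b /asboolP ca /asboolP cb|a b /asboolP ca /asboolP cb]; apply/asboolP.
- exact: coherent1.
- exact: (coherentB scaling_at_inj).
- exact: (coherentM scaling_at_inj below_refl).
Qed.

HB.instance Definition _ :=
  GRing.isSubringClosed.Build Q coherent_pred coherent_subring.

Record coherent_ring :=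
  CoherentElt { coherent_val : Q; _ : coherent_val \in coherent_pred }.

HB.instance Definition _ := [isSub for coherent_val].
HB.instance Definition _ := [Choice of coherent_ring by <:].
HB.instance Definition _ :=
  GRing.SubChoice_isSubComPzRing.Build _ _ coherent_ring coherent_subring.

End CoherentRing.

Section Centers.
Variables (E : eqType) (T : Type) (S : T -> set E).
Local Notation P := (GRing.IntegralDomain.clone (polyfun E) _).
Local Notation Q := {fraction P}.
Local Notation A := (coherent_ring S).
Local Notation phi := (scaling_at S).
Implicit Types (t : T) (a b : A) (e : E) (l : seq E).

Lemma coherent_valP a : coherent phi (below S) (coherent_val a).
Proof. by apply/asboolP; exact: (valP a). Qed.

Lemma coherent_val_vge0 a t : vge (phi t) 0 (coherent_val a).
Proof.
have inj := @scaling_at_inj _ _ S; have refl := @below_refl _ _ S.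
exact: (coherent_vge0 inj refl t (coherent_valP a)).
Qed.

Lemma coherent_valX a n : coherent_val (a ^+ n) = coherent_val a ^+ n.
Proof. by elim: n => [//|n IH]; rewrite !exprS -IH. Qed.

Definition center_set t : set A := [set a | vge (phi t) 1 (coherent_val a)].

Lemma center0 t : center_set t 0.
Proof. exact: vge_0. Qed.

Lemma centerD t a b : center_set t a -> center_set t b -> center_set t (a + b).
Proof. exact: (vgeD (@scaling_at_inj _ _ S t)). Qed.

Lemma centerMr t a b : center_set t b -> center_set t (a * b).
Proof.
by move=> hb; exact: (vge01M (@scaling_at_inj _ _ S t) (coherent_val_vge0 a t) hb).
Qed.

Lemma center1 t : ~ center_set t 1.
Proof.
rewrite /center_set/= => h.
have : vge (phi t) 1 (tofrac 1) by rewrite tofrac1.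
rewrite vge1_tofrac; last exact: scaling_at_inj.
by rewrite rmorph1 coef1 eqxx oner_eq0.
Qed.

Lemma centerM t a b : center_set t (a * b) -> center_set t a \/ center_set t b.
Proof.
move=> h; apply: vge1_prime => //; first exact: scaling_at_inj.
- exact: coherent_val_vge0.
- exact: coherent_val_vge0.
Qed.

Definition center t : prime_ideal A :=
  PrimeIdeal (center0 t) (@centerD t) (@centerMr t) (@center1 t) (@centerM t).

Lemma centerE t a : prime_set (center t) a = vge (phi t) 1 (coherent_val a).
Proof. by []. Qed.

Lemma indet_coherent e : coherent phi (below S) (tofrac (indet e)).
Proof.
move=> t t' tt'; have [Se|nSe] := pselect (S t' e).
  exists (tofrac (indet e)); rewrite subrr; split; try exact: vge_0.
  by apply: fixed_field_tofrac; exact: scaling_indet_in.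
have nS u : ~ S u e -> vge (phi u) 1 (tofrac (indet e)).
  move=> nSu; rewrite vge1_tofrac; last exact: scaling_at_inj.
  by rewrite /scaling_at/= scaling_indet_notin// coefMX eqxx.
exists 0; rewrite subr0; split; [exact: fixed_field0| |exact: nS].
by apply: nS => /tt'.
Qed.

Definition var e : A := CoherentElt (asboolT (indet_coherent e)).

Lemma center_var t e : prime_set (center t) (var e) <-> ~ S t e.
Proof.
rewrite centerE vge1_tofrac; last exact: scaling_at_inj.
have [Se|nSe] := pselect (S t e).
  rewrite /scaling_at/= scaling_indet_in// coefC/=; split => // /eqP.
  by move=> /(congr1 (fun f : polyfun E => f (fun=> 1)))/eqP; rewrite polyfun0 oner_eq0.
by rewrite /scaling_at/= scaling_indet_notin// coefMX eqxx.
Qed.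

Lemma coherent_val_sum l :
  coherent_val (\sum_(e <- l) var e) = tofrac (\sum_(e <- l) indet e).
Proof.
elim: l => [|e l IH]; first by rewrite !big_nil tofrac0.
by rewrite !big_cons tofracD -IH.
Qed.

(** The sum does not cancel at [t]: modulo the variables outside [S t] it becomes a
    sum of variables, which is positive at the point with all coordinates 1. *)
Lemma center_sum_var t l : prime_set (center t) (\sum_(e <- l) var e) ->
  forall e, e \in l -> ~ S t e.
Proof.
rewrite centerE coherent_val_sum vge1_tofrac; last exact: scaling_at_inj.
move=> /eqP/(congr1 (fun f : polyfun E => f (fun=> 1))); rewrite polyfun0.
rewrite raddf_sum coef_sum polyfun_sum => /eqP.
have E1 e : ((scaling (S t) (indet e))`_0 : P) (fun=> 1) = (`[< S t e >])%:R.
  case: asboolP => Se; first by rewrite scaling_indet_in// coefC.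
  by rewrite scaling_indet_notin// coefMX eqxx polyfun0.
rewrite psumr_eq0 => [|e _]; last by rewrite E1 ler0n.
by move=> /allP h e /h; rewrite /= E1; case: asboolP.
Qed.

Lemma vge_support (a : Q) : exists L : seq E, forall t t',
  agree L (S t) (S t') -> vge (phi t) 1 a = vge (phi t') 1 a.
Proof.
have [f [g [g0 ->]]] := fracE a.
have [->|f0] := eqVneq f 0.
  by exists [::] => t t' _; rewrite tofrac0 mul0r !vge_0.
have [L HL] := scaling_support f; have [M HM] := scaling_support g.
have fg0 : tofrac f / tofrac g != 0.
  by rewrite mulf_neq0 ?invr_eq0 ?tofrac_eq0.
exists (L ++ M) => t t' tt'; rewrite !vge_nz//.
have inj := @scaling_at_inj _ _ S.
rewrite (ordval_frac (@inj t))// (ordval_frac (@inj t'))// /scaling_at/=.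
by rewrite (HL _ (S t')) ?(HM _ (S t'))// => e eL; apply: tt'; rewrite mem_cat eL ?orbT.
Qed.

Lemma scaling_at_degree : degree_bounded phi.
Proof.
move=> f; have [d Hd] := scaling_size f; exists d => t; split.
  by have := Hd (S t) setT 0%N; rewrite scaling_setT coefC.
by move=> t' i; exact: Hd.
Qed.

Lemma center_setT t a : S t = setT -> prime_set (center t) a -> a = 0.
Proof.
move=> St; rewrite centerE => h; apply: val_inj => /=.
have Ka : fixed_field (phi t) (coherent_val a).
  have [f [g [g0 ->]]] := fracE (coherent_val a).
  by exists f, g; split=> //; rewrite /scaling_at/= St scaling_setT.
exact: (fixed_field_vge1 (@scaling_at_inj _ _ S t) Ka).
Qed.

(** Some power of [b] is a multiple of [a], unless [a = 0]; then [b] is in the center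
    of [top], which is the zero ideal. *)
Lemma center_dominates (top : T) a b : S top = setT ->
  (forall t, prime_set (center t) a -> prime_set (center t) b) ->
  forall p : prime_ideal A, prime_set p a -> prime_set p b.
Proof.
move=> Stop ab p pa; have [a0|a0] := eqVneq a 0.
  rewrite (@center_setT top b) //; first exact: prime0.
  by apply: ab; rewrite a0; exact: prime0.
have va0 : coherent_val a != 0.
  by apply/eqP => h; case/negP: a0; apply/eqP; exact: val_inj.
have [n cn] := coherent_divides (@scaling_at_inj _ _ S) (@below_refl _ _ S)
  scaling_at_degree (coherent_valP a) (coherent_valP b) va0 ab.
have bn : b ^+ n = CoherentElt (asboolT cn) * a.
  by apply: val_inj => /=; rewrite coherent_valX divfK.
by apply: (@prime_expE _ _ _ n); rewrite bn; exact: primeMr.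
Qed.

End Centers.

(** * Spectral spaces from algebraic closure systems *)

Definition entails (T E : Type) (S : T -> set E) (D : set E) (y : E) :=
  forall t, D `<=` S t -> S t y.

(** The sets [S t] are the closed sets of a closure operator for which closed sets
    are recognized on finite subsets. *)
Definition algebraic_closure_system (E : eqType) (T : Type) (S : T -> set E) :=
  forall Z : set E,
    (forall (l : seq E) y, [set` l] `<=` Z -> entails S [set` l] y -> Z y) ->
  exists t, S t = Z.

Section ClosureSystem.
Variables (E : eqType) (T : Type) (S : T -> set E).
Hypothesis S_inj : injective S.
Hypothesis S_closure : algebraic_closure_system S.
Local Notation A := (coherent_ring S).
Local Notation P := (center S).
Local Notation x := (var S).
Implicit Types (t : T) (a b : A) (e : E) (l : seq E).

Lemma closure_top : exists t, S t = setT.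
Proof. by apply: S_closure. Qed.

(** The closure of a finite set. *)
Lemma closure_exists l : exists t,
  [set` l] `<=` S t /\ forall t', [set` l] `<=` S t' -> S t `<=` S t'.
Proof.
have [|t St] := @S_closure (entails S [set` l]).
  move=> l' y l'l l'y t lt; apply: l'y => e el; exact: (l'l e el t lt).
by exists t; rewrite St; split=> [e el t' lt'|t' lt' e]; [exact: lt'|exact].
Qed.

Lemma dominates a b : (forall t, prime_set (P t) a -> prime_set (P t) b) ->
  forall p : prime_ideal A, prime_set p a -> prime_set p b.
Proof. by have [top Stop] := closure_top; exact: (center_dominates Stop). Qed.

Lemma center_prod_var t l : ~ [set` l] `<=` S t ->
  prime_set (P t) (\prod_(e <- l) x e).
Proof.
move=> /existsNP[e /not_implyP[el Se]]; apply/prime_prodE.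
by exists e => //; exact/center_var.
Qed.

Lemma prod_var_center t l : ~ prime_set (P t) (\prod_(e <- l) x e) ->
  [set` l] `<=` S t.
Proof. by move=> nP; apply: contrapT => /center_prod_var. Qed.

(** With [l] the variables of [a] in [S t], the closure of [l] meets the variables of
    [a] in [l] again, so [a] is a unit there, and then at every larger point. *)
Lemma notin_center_nbhs t a : ~ prime_set (P t) a -> exists l,
  [set` l] `<=` S t /\ forall t', [set` l] `<=` S t' -> ~ prime_set (P t') a.
Proof.
move=> na; have [L HL] := vge_support S (coherent_val a).
pose l := [seq e <- L | `[< S t e >]].
have lS : [set` l] `<=` S t by move=> e /=; rewrite mem_filter => /andP[/asboolP].
exists l; split=> // t' lt'.
have [t1 [lt1 t1min]] := closure_exists l.
have nt1 : ~ prime_set (P t1) a.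
  rewrite centerE (HL t1 t) => [//|e eL]; split; first exact: t1min.
  by move=> Se; apply: lt1 => /=; rewrite mem_filter asboolT.
move=> at'; apply: nt1; rewrite centerE.
have inj := @scaling_at_inj _ _ S.
exact: (coherent_mono inj (coherent_valP a) (t1min _ lt')).
Qed.

(** An element of [p] outside the center of [t] would divide a power of a product
    of variables in [S t].  An element [a] of the center lies in [p] because the
    sum of its variables outside [S t], an element of [p], divides a power of [a]
    times the product of its variables in [S t]. *)
Lemma prime_is_center (p : prime_ideal A) : exists t, P t = p.
Proof.
have [|t St] := @S_closure [set e | ~ prime_set p (x e)].
  move=> l y lZ ly py.
  have /prime_prodE[e el pe] : prime_set p (\prod_(e <- l) x e).
    apply: (@dominates (x y)) => // t /center_var ny.
    by apply: center_prod_var => /ly.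
  exact: (lZ e el pe).
exists t; apply: prime_ideal_ext => a; apply/propext; split.
  move=> ta; have [L HL] := vge_support S (coherent_val a).
  (* Where the sum over [m] is in a center but the product over [l] is not, the point
     has the same variables from [L] as [t]. *)
  pose l := [seq e <- L | `[< S t e >]]; pose m := [seq e <- L | `[< ~ S t e >]].
  have pz : prime_set p (\sum_(e <- m) x e).
    apply: prime_sum => e; rewrite mem_filter St => /andP[/asboolP + _].
    exact: contrapT.
  have : prime_set p (a * \prod_(e <- l) x e).
    apply: dominates pz => t' zt'.
    have [lt'|nlt'] := pselect ([set` l] `<=` S t'); last first.
      exact/primeMr/center_prod_var.
    rewrite mulrC; apply: primeMr; rewrite centerE (HL t' t) => [//|e eL]; split.
      move=> t'e; apply: contrapT => nte; apply: (center_sum_var zt' _ t'e).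
      by rewrite mem_filter eL asboolT.
    by move=> te; apply: lt' => /=; rewrite mem_filter eL asboolT.
  move=> /primeM[//|/prime_prodE[e]]; rewrite mem_filter => /andP[/asboolP + _].
  by rewrite St.
move=> pa; apply: contrapT => /notin_center_nbhs[l [lt lmin]].
have /prime_prodE[e el pe] : prime_set p (\prod_(e <- l) x e).
  apply: dominates pa => t' at'; apply: center_prod_var => lt'.
  exact: (lmin _ lt').
by have := lt e el; rewrite St.
Qed.

Lemma center_inj : injective P.
Proof.
move=> t t' tt'; apply: S_inj; apply/seteqP; split=> e te; apply: contrapT.
  by move/center_var; rewrite -tt' => /center_var.
by move/center_var; rewrite tt' => /center_var.
Qed.

End ClosureSystem.

(** The last two hypotheses say that the sets [[set t | S t e]] form a subbasis.  As
    the centers are all the prime ideals, it remains to compare the topologies: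
    [S t e] means that the variable [e] is not in the center of [t], and the
    elements outside a center stay outside in a subbasic neighborhood. *)
Theorem closure_system_spectral (T : topologicalType) (E : eqType)
    (S : T -> set E) :
    injective S -> algebraic_closure_system S ->
    (forall e, open [set t | S t e]) ->
    (forall (U : set T) t, open U -> U t -> exists l : seq E,
      [set` l] `<=` S t /\ forall t', [set` l] `<=` S t' -> U t') ->
  spectral_space T.
Proof.
move=> S_inj S_clo S_open S_basis.
exists (coherent_ring S); exists (center S).
pose g p := projT1 (cid (prime_is_center S_clo p)).
have gK : cancel g (center S) by move=> p; rewrite /g; case: cid.
have Kg : cancel (center S) g.
  by move=> t; apply: (center_inj S_inj); exact: gK.
have open_incl (l : seq E) : open [set t | [set` l] `<=` S t].
  elim: l => [|e l IH].
    have -> : [set t | [set` [::]] `<=` S t] = setT by apply/seteqP; split.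
    exact: openT.
  have -> : [set t | [set` e :: l] `<=` S t] =
      [set t | S t e] `&` [set t | [set` l] `<=` S t].
    apply/seteqP; split=> [t h|t [te h] e' /=].
      split; first by apply: h; rewrite /= mem_head.
      by move=> e' el; apply: h; rewrite /= inE el orbT.
    by rewrite inE => /orP[/eqP ->|/h].
  exact: openI.
exists g; split=> //; apply/continuousP => U Uo.
  rewrite openE => t Ut; have [W UE] : spec_open U by [].
  move: Ut; rewrite /= UE => /existsNP[a /not_implyP[Wa nta]].
  have [l [lt lmin]] := notin_center_nbhs S_clo nta.
  rewrite /interior nbhsE; exists [set t' | [set` l] `<=` S t'] => //= t' /lmin nat' WP.
  exact/nat'/WP.
rewrite openE => p Up; have [l [lt lmin]] := S_basis _ _ Uo Up.
rewrite /interior nbhsE; exists [set q | ~ prime_set q (\prod_(e <- l) var S e)].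
split; first exact: open_prime_notin.
  rewrite /= -(gK p) => /prime_prodE[e el /center_var]; apply.
  exact: lt.
by move=> q nq; apply: lmin; apply: prod_var_center; rewrite gK.
Qed.

(** * Finitely generated submodules *)

Section FinitelyGenerated.
Variable A : idomainType.
Local Notation K := {fraction A}.
Implicit Types (F G H : nzsubmod A) (l : seq K).

Lemma nzsubmod_ext F G : F = G :> set K -> F = G.
Proof.
case: F G => [F F0 FD FZ Fn] [G G0 GD GZ Gn] /= e; subst G.
by congr NzSubmod; exact: Prop_irrelevance.
Qed.

Definition gen_span l : set K := [set x | exists c : 'I_(size l) -> A,
  x = \sum_(i < size l) tofrac (c i) * l`_i].

Lemma gen_span_min l F : [set` l] `<=` F -> gen_span l `<=` F.
Proof.
move=> lF _ [c ->]; elim/big_ind: _ => [|x y|i _]; first exact: submod0.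
  exact: submodD.
by apply/submodZ/lF; exact: mem_nth.
Qed.

Lemma mem_gen_span l : [set` l] `<=` gen_span l.
Proof.
move=> x xl; have il : (index x l < size l)%N by rewrite index_mem.
exists (fun i => (i == Ordinal il)%:R); rewrite (bigD1 (Ordinal il))//= eqxx.
rewrite tofrac1 mul1r nth_index// big1 ?addr0// => i /negPf ->.
by rewrite tofrac0 mul0r.
Qed.

Lemma gen_span0 l : gen_span l 0.
Proof. by exists (fun=> 0); rewrite big1// => i _; rewrite tofrac0 mul0r. Qed.

Lemma gen_spanD l x y : gen_span l x -> gen_span l y -> gen_span l (x + y).
Proof.
move=> [c ->] [d ->]; exists (fun i => c i + d i); rewrite -big_split/=.
by apply: eq_bigr => i _; rewrite tofracD mulrDl.
Qed.

Lemma gen_spanZ l (a : A) x : gen_span l x -> gen_span l (tofrac a * x).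
Proof.
move=> [c ->]; exists (fun i => a * c i); rewrite big_distrr/=.
by apply: eq_bigr => i _; rewrite tofracM mulrA.
Qed.

(** A nonzero element of [F] is added to [l], whose entries may all be 0. *)
Lemma fin_gen_exists l F : [set` l] `<=` F -> exists G,
  [/\ fin_gen G, G `<=` F & [set` l] `<=` G].
Proof.
have [u Fu u0] := submod_neq0 F; move=> lF.
have nz : exists2 x, gen_span (u :: l) x & x != 0.
  by exists u => //; apply: mem_gen_span; rewrite /= mem_head.
exists (NzSubmod (@gen_span0 _) (@gen_spanD _) (@gen_spanZ _) nz); split.
- by exists (u :: l).
- by apply: gen_span_min => x; rewrite /= inE => /orP[/eqP ->|/lF].
- by move=> x xl; apply: mem_gen_span; rewrite /= inE xl orbT.
Qed.

Lemma fin_gen_gens F : fin_gen F -> exists l : seq K,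
  [set` l] `<=` F /\ forall G, [set` l] `<=` G -> F `<=` G.
Proof.
move=> [l Fl]; exists l; rewrite Fl; split; first exact: mem_gen_span.
by move=> G; exact: gen_span_min.
Qed.

Lemma fin_gen_join F G H : fin_gen G -> G `<=` F -> fin_gen H -> H `<=` F ->
  exists J, [/\ fin_gen J, J `<=` F, G `<=` J & H `<=` J].
Proof.
move=> /fin_gen_gens[l [lG Gmin]] GF /fin_gen_gens[m [mH Hmin]] HF.
have [|J [fJ JF lmJ]] := @fin_gen_exists (l ++ m) F.
  by move=> x; rewrite /= mem_cat => /orP[/lG/GF|/mH/HF].
exists J; split=> //; [apply: Gmin|apply: Hmin] => x xl; apply: lmJ.
  by rewrite /= mem_cat xl.
by rewrite /= mem_cat xl orbT.
Qed.

Lemma fin_gen_scale (k : K) (k0 : k != 0) F :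
  fin_gen F -> fin_gen (scale_nzsubmod k0 F).
Proof.
move=> [l Fl]; exists [seq k * x | x <- l]; apply/seteqP; split=> y.
  move=> [x]; rewrite Fl => -[c ->] <-.
  have sz : size [seq k * x | x <- l] = size l by rewrite size_map.
  exists (fun i => c (cast_ord sz i)); rewrite big_distrr/=.
  rewrite (reindex (cast_ord sz))/=; last first.
    by exists (cast_ord (esym sz)) => i _; rewrite ?cast_ordK ?cast_ordKV.
  apply: eq_bigr => i _; rewrite mulrCA (nth_map 0)//.
  by have := ltn_ord i; rewrite [X in (_ < X)%N]sz.
move=> [c ->]; rewrite /=; elim/big_ind: _.
- exact: scale_set0.
- by move=> x z; exact: scale_setD.
- move=> i _; apply: scale_setZ.
  have il : (i < size l)%N by have := ltn_ord i; rewrite [X in (_ < X)%N]size_map.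
  by rewrite (nth_map 0)//; exists l`_i => //; rewrite Fl; apply: mem_gen_span; exact: mem_nth.
Qed.

Lemma scale_nzsubmodE (k : K) (k0 : k != 0) F x :
  submod_set (scale_nzsubmod k0 F) x <-> submod_set F (k^-1 * x).
Proof.
split=> [[y Fy <-]|Fx]; first by rewrite mulKf.
by exists (k^-1 * x); rewrite // mulVKf.
Qed.

Lemma star_scaleE (s : semistar A) (k : K) (k0 : k != 0) F x :
  submod_set (s (scale_nzsubmod k0 F)) x <-> submod_set (s F) (k^-1 * x).
Proof. by rewrite star_scale; exact: scale_nzsubmodE. Qed.

Lemma star_le (s : semistar A) F G : F `<=` s G -> s F `<=` s G.
Proof. by rewrite -{2}(star_idem s G); exact: star_mono. Qed.

Lemma semistar_ext (s s' : semistar A) : (forall F, s F = s' F :> set K) -> s = s'.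
Proof.
move=> ss'; have : star s = star s'.
  by apply/funext => F; apply: nzsubmod_ext; exact: ss'.
case: s s' {ss'} => [s a b c d] [s' a' b' c' d'] /= e; subst s'.
by congr Semistar; exact: Prop_irrelevance.
Qed.

End FinitelyGenerated.

(** * Semistar operations of finite type as an algebraic closure system *)

Section FiniteTypeSemistar.
Variable A : idomainType.
Local Notation K := {fraction A}.
Local Notation fgmod := (set_type [set F : nzsubmod A | fin_gen F]).
Local Notation fsemistar := (set_type (semistar_f A)).
Implicit Types (F G H : nzsubmod A) (s t : fsemistar) (x y : K).

Definition fstar s : semistar A := set_val s.

Definition FgMod F (fF : fin_gen F) : fgmod := exist _ F (mem_set fF).

Definition modules_at_one s : set fgmod := [set G | submod_set (fstar s (set_val G)) 1].

Lemma finite_typeE s F x : submod_set (fstar s F) x ->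
  exists G, [/\ fin_gen G, G `<=` F & submod_set (fstar s G) x].
Proof.
have := set_mem (valP s) => /(_ F); rewrite -/(fstar s) => -> [G [fG GF] Gx].
by exists G.
Qed.

(** For nonzero [x], membership of [x] in the star of [G] says that the module
    [x^-1 G] belongs to the set. *)
Lemma modules_at_one_inj : injective modules_at_one.
Proof.
move=> s t st_eq; apply: val_inj; rewrite -[val s]/(fstar s) -[val t]/(fstar t).
suff le u v : modules_at_one u = modules_at_one v -> forall F, fstar u F `<=` fstar v F.
  by apply: semistar_ext => F; apply/seteqP; split; apply: le.
move=> uv F x /finite_typeE[G [fG GF]]; have [->|x0] := eqVneq x 0.
  by move=> _; exact: submod0.
have xV0 : x^-1 != 0 by rewrite invr_eq0.
move=> Gx; have : modules_at_one u (FgMod (fin_gen_scale xV0 fG)).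
  by apply/star_scaleE; rewrite invrK mulr1.
rewrite uv => /star_scaleE; rewrite invrK mulr1.
exact: star_mono.
Qed.

Section Closure.
Variable Z : set fgmod.
Hypothesis Zclosed : forall (l : seq fgmod) (G : fgmod),
  [set` l] `<=` Z -> entails modules_at_one [set` l] G -> Z G.

(** What [Z] forces into the star of a finitely generated submodule of [F].  Phrased
    with all operations of finite type, the definition lets the axioms of semistar
    operations be checked inside those operations. *)
Definition star_set F : set K := [set x | exists (l : seq fgmod) G,
  [/\ [set` l] `<=` Z, fin_gen G, G `<=` F &
      forall s, [set` l] `<=` modules_at_one s -> submod_set (fstar s G) x]].

(** The submodules that witness the memberships have a finitely generated sum. *)
Lemma star_set_gather F (xs : seq K) : [set` xs] `<=` star_set F ->
  exists (l : seq fgmod) G, [/\ [set` l] `<=` Z, fin_gen G, G `<=` F &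
    forall s, [set` l] `<=` modules_at_one s -> [set` xs] `<=` fstar s G].
Proof.
elim: xs => [|x xs IH] xsF.
  have [|G [fG GF _]] := @fin_gen_exists _ [::] F; first by [].
  by exists [::], G; split.
have [|l [G [lZ fG GF xsG]]] := IH.
  by move=> y yxs; apply: xsF; rewrite /= inE yxs orbT.
have [m [H [mZ fH HF xH]]] := xsF x (mem_head _ _).
have [J [fJ JF GJ HJ]] := fin_gen_join fG GF fH HF.
exists (l ++ m), J; split=> //.
  by move=> y; rewrite /= mem_cat => /orP[/lZ|/mZ].
move=> s slm y; rewrite /= inE => /orP[/eqP ->|yxs].
  by apply: (star_mono HJ); apply: xH => G' G'm; apply: slm; rewrite /= mem_cat G'm orbT.
by apply: (star_mono GJ); apply: xsG => // G' G'l; apply: slm; rewrite /= mem_cat G'l.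
Qed.

Lemma star_set_deduce F (xs : seq K) y : [set` xs] `<=` star_set F ->
  (forall s G, [set` xs] `<=` fstar s G -> submod_set (fstar s G) y) -> star_set F y.
Proof.
move=> /star_set_gather[l [G [lZ fG GF h]]] xsy; exists l, G; split=> // s sl.
exact/xsy/h.
Qed.

Lemma star_set0 F : star_set F 0.
Proof. by apply: (@star_set_deduce _ [::]) => // s G _; exact: submod0. Qed.

Lemma star_setD F x y : star_set F x -> star_set F y -> star_set F (x + y).
Proof.
move=> Fx Fy; apply: (@star_set_deduce _ [:: x; y]) => [z|s G xyG].
  by rewrite /= !inE => /orP[]/eqP ->.
by apply: submodD; apply: xyG; rewrite /= !inE eqxx ?orbT.
Qed.

Lemma star_setZ F (a : A) x : star_set F x -> star_set F (tofrac a * x).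
Proof.
move=> Fx; apply: (@star_set_deduce _ [:: x]) => [z|s G xG].
  by rewrite /= !inE => /eqP ->.
by apply/submodZ/xG; rewrite /= mem_head.
Qed.

Lemma star_set_ext F : F `<=` star_set F.
Proof.
move=> x Fx; have [|G [fG GF xG]] := @fin_gen_exists _ [:: x] F.
  by move=> y; rewrite /= inE => /eqP ->.
exists [::], G; split=> // s _; apply/star_ext/xG.
by rewrite /= mem_head.
Qed.

Lemma star_set_neq0 F : exists2 x, star_set F x & x != 0.
Proof. by have [x Fx x0] := submod_neq0 F; exists x => //; exact: star_set_ext. Qed.

Definition star_mod F : nzsubmod A := NzSubmod (@star_set0 F) (@star_setD F)
  (@star_setZ F) (star_set_neq0 F).

Lemma star_set_scale_le (k : K) (k0 : k != 0) F x :
  star_set F x -> star_set (scale_nzsubmod k0 F) (k * x).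
Proof.
move=> [l [G [lZ fG GF Gx]]]; exists l, (scale_nzsubmod k0 G); split=> //.
- exact: fin_gen_scale.
- by move=> y /scale_nzsubmodE/GF Fy; exact/scale_nzsubmodE.
- by move=> s /Gx h; apply/star_scaleE; rewrite mulKf.
Qed.

Lemma star_mod_scale (k : K) (k0 : k != 0) F :
  star_mod (scale_nzsubmod k0 F) = scale_nzsubmod k0 (star_mod F).
Proof.
apply: nzsubmod_ext; apply/seteqP; split=> x; last first.
  by move=> [y Fy <-]; exact: star_set_scale_le.
move=> h; apply/scale_nzsubmodE.
have kV0 : k^-1 != 0 by rewrite invr_eq0.
have := @star_set_scale_le _ kV0 _ _ h; congr (star_set _ _).
apply: nzsubmod_ext; apply/seteqP; split=> y.
  by move=> /scale_nzsubmodE/scale_nzsubmodE; rewrite invrK mulKf.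
by move=> Fy; apply/scale_nzsubmodE/scale_nzsubmodE; rewrite invrK mulKf.
Qed.

Lemma star_mod_mono F G : F `<=` G -> star_mod F `<=` star_mod G.
Proof.
move=> FG x [l [H [lZ fH HF Hx]]]; exists l, H; split=> //.
exact: subset_trans FG.
Qed.

Lemma star_mod_idem F : star_mod (star_mod F) = star_mod F.
Proof.
apply: nzsubmod_ext; apply/seteqP; split=> x; last exact: star_set_ext.
move=> [l [G [lZ fG GF Gx]]]; have [gs [gsG Gmin]] := fin_gen_gens fG.
have [|m [H [mZ fH HF gsH]]] := @star_set_gather F gs; first by move=> y /gsG/GF.
exists (l ++ m), H; split=> //.
  by move=> y; rewrite /= mem_cat => /orP[/lZ|/mZ].
move=> s slm; have GH : G `<=` fstar s H.
  by apply/Gmin/gsH => G' G'm; apply: slm; rewrite /= mem_cat G'm orbT.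
apply: (star_le GH); apply: Gx => G' G'l; apply: slm.
by rewrite /= mem_cat G'l.
Qed.

Definition semistar_of : semistar A :=
  Semistar star_mod_scale star_mod_mono star_set_ext star_mod_idem.

Lemma semistar_of_finite_type : finite_type semistar_of.
Proof.
move=> F; apply/seteqP; split=> x.
  by move=> [l [G [lZ fG GF Gx]]]; exists G => //; exists l, G; split.
by move=> [G [_ GF]]; exact: star_mod_mono.
Qed.

Definition fsemistar_of : fsemistar := exist _ semistar_of (mem_set semistar_of_finite_type).

Lemma modules_at_one_semistar_of : modules_at_one fsemistar_of = Z.
Proof.
apply/seteqP; split=> G.
  move=> [l [H [lZ fH HG H1]]]; apply: (Zclosed lZ) => s /H1.
  exact: star_mono.
move=> ZG; exists [:: G], (set_val G); split=> //.
- by move=> H; rewrite /= inE => /eqP ->.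
- exact: (set_mem (valP G)).
- by move=> s; apply; rewrite /= mem_head.
Qed.

End Closure.

Lemma modules_at_one_closure_system : algebraic_closure_system modules_at_one.
Proof. by move=> Z Zc; exists (fsemistar_of Z); exact: modules_at_one_semistar_of. Qed.

Lemma open_modules_at_one (G : fgmod) : open [set s | modules_at_one s G].
Proof.
have [U Uo UE] : exists2 U : set (semistar A), open U &
    [set s : fsemistar | modules_at_one s G] = set_val @^-1` U.
  exists (zariski_subbase (set_val G)) => //.
  exists [set zariski_subbase (set_val G)]; last by rewrite bigcup_set1.
  move=> _ ->; exists [fset (set_val G)]%fset; first by move=> F _; rewrite inE.
  by apply/seteqP; split=> [u|u Gu i]; [apply; rewrite /= inE|rewrite /= inE => /eqP ->].
by rewrite UE; exists U.
Qed.

(** A basic open set constrains the stars of finitely many modules, which finite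
    type allows to replace by finitely generated submodules. *)
Lemma open_modules_at_one_basis (U : set fsemistar) s : open U -> U s ->
  exists l : seq fgmod, [set` l] `<=` modules_at_one s /\
    forall t, [set` l] `<=` modules_at_one t -> U t.
Proof.
move=> [V [D sD <-] <-] [C DC Cs]; have [fs _ fsC] := sD _ DC.
have {}Cs : C (fstar s) by [].
suff [l [ls lfs]] : exists l : seq fgmod, [set` l] `<=` modules_at_one s /\
    forall t, [set` l] `<=` modules_at_one t ->
      forall F, F \in (fs : seq _) -> submod_set (fstar t F) 1.
  exists l; split=> // t lt; exists C => //; suff : C (fstar t) by [].
  rewrite -fsC => F Ffs.
  exact: (lfs _ lt F Ffs).
have : forall F, F \in (fs : seq _) -> submod_set (fstar s F) 1.
  by move=> F Ffs; move: Cs; rewrite -fsC => /(_ F Ffs).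
elim: (fs : seq _) => [|F Fs IH] h; first by exists [::].
have [|l [ls lFs]] := IH; first by move=> F' F'l; apply: h; rewrite inE F'l orbT.
have [G [fG GF G1]] := finite_typeE (h F (mem_head _ _)).
exists (FgMod fG :: l); split.
  by move=> G'; rewrite /= inE => /orP[/eqP ->//|/ls].
move=> t lt F'; rewrite inE => /orP[/eqP ->|].
  by apply: (star_mono GF); apply: (lt (FgMod fG)); rewrite /= mem_head.
by apply: lFs => G' G'l; apply: lt; rewrite /= inE G'l orbT.
Qed.

End FiniteTypeSemistar.

Theorem theorem2p13 (A : idomainType) :
  spectral_space (set_type (semistar_f A)).
Proof.
exact: (closure_system_spectral (@modules_at_one_inj A) (@modules_at_one_closure_system A)
  (@open_modules_at_one A) (@open_modules_at_one_basis A)).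
Qed.
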